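(* Let $X$ be a finite triangle complex (a finite simplicial complex of dimension $2$) on $n$ vertices. Suppose that the nontrivial spectrum of $\Delta_0^+$ is contained in $[k_0-\mu_0,k_0+\mu_0]$, and that the nontrivial spectrum of $\Delta_1^+$ is bounded below by $\lambda_1$. Then for every partition of the vertex set of $X$ into nonempty sets $A,B,C$, \[ \frac{|T(A,B,C)|\,n^{2}}{|A||B||C|}\geq\lambda_{1}\left(k_{0}-\mu_{0}\left(1+\frac{10\,n^{3}}{9|A||B||C|}\right)\right), \] where $T(A,B,C)$ is the set of triangles of $X$ with one vertex in each of $A$, $B$ and $C$.
   Context: For a finite simplicial complex $X$, let $X^i$ be its set of $i$-cells. $\Omega^i$ is the space of complex-valued skew-symmetric functions on oriented $i$-cells (for $i=0$: functions on vertices; $\Omega^{-1}=\mathbb{C}$), with inner product $\langle f,g\rangle=\sum_{\sigma\in X^i}f(\sigma)\overline{g(\sigma)}$ (one orientation chosen per cell). The boundary map $\partial_i:\Omega^i\to\Omega^{i-1}$ is $(\partial_i f)(\sigma)=\sum_{v:\,v\sigma\in X^i}f(v\sigma)$ (so $\partial_0 f=\sum_v f(v)$), and $\delta_i=\partial_i^*:\Omega^{i-1}\to\Omega^i$, $(\delta_i f)(\sigma)=\sum_{j=0}^i(-1)^j f(\sigma\setminus\sigma_j)$. The upper Laplacian is $\Delta_i^+=\partial_{i+1}\delta_{i+1}$; $\Delta_0^+$ is the graph Laplacian $(\Delta_0^+f)(v)=\deg(v)f(v)-\sum_{w\sim v}f(w)$. With $Z_i=\ker\partial_i$, the nontrivial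 spectrum of $\Delta_i^+$ is the spectrum of $\Delta_i^+$ restricted to the invariant subspace $Z_i$ (for $i=0$, functions with zero sum).
   Formalization: The formal statement adds the assumption that λ₁ ≥ 0; without it the claim fails, e.g. for a single full triangle with k₀=3, μ₀=1, λ₁=−1 and singleton parts, where the left side is 9 and the right side is 28. *)

(* Defs.v *)
From HB Require Import structures.
From mathcomp Require Import all_boot all_order all_algebra.
Set Implicit Arguments. Unset Strict Implicit. Unset Printing Implicit Defensive.
Import Order.TTheory GRing.Theory Num.Theory.
Local Open Scope ring_scope.

Definition is_triangle_complex (n : nat) (E T : {set {set 'I_n}}) : Prop :=
  [/\ (forall e, e \in E -> #|e| = 2%N),
      (forall t, t \in T -> #|t| = 3%N),
      (forall (t e : {set 'I_n}), t \in T -> e \subset t -> #|e| = 2%N -> e \in E)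
    & T != set0 (* dimension exactly 2 *)].

Section Ops.
Variables (C : numClosedFieldType) (n : nat) (E T : {set {set 'I_n}}).

(* Omega^1 : skew-symmetric functions on oriented edges,
   represented as functions on ordered pairs vanishing off edges. *)
Definition Omega1 (f : 'I_n -> 'I_n -> C) : Prop :=
  (forall a b, f a b = - f b a) /\
  (forall a b, [set a; b] \notin E -> f a b = 0).

Definition bd0 (f : 'I_n -> C) : C := \sum_v f v.
Definition bd1 (f : 'I_n -> 'I_n -> C) : 'I_n -> C :=
  fun a => \sum_(v | [set v; a] \in E) f v a.
Definition bd2 (g : 'I_n -> 'I_n -> 'I_n -> C) : 'I_n -> 'I_n -> C :=
  fun a b => \sum_(v | [set v; a; b] \in T) g v a b.

(* coboundary maps delta_i = bd_i^* *)
Definition delta1 (f : 'I_n -> C) : 'I_n -> 'I_n -> C :=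
  fun a b => f b - f a.
Definition delta2 (f : 'I_n -> 'I_n -> C) : 'I_n -> 'I_n -> 'I_n -> C :=
  fun a b c => f b c - f a c + f a b.

Definition uplap0 (f : 'I_n -> C) : 'I_n -> C := bd1 (delta1 f).
Definition uplap1 (f : 'I_n -> 'I_n -> C) : 'I_n -> 'I_n -> C := bd2 (delta2 f).

Definition nontriv_spec0_in (S : pred C) : Prop :=
  forall (f : 'I_n -> C) (lam : C),
    bd0 f = 0 -> (exists v, f v != 0) ->
    (forall v, uplap0 f v = lam * f v) -> S lam.

Definition nontriv_spec1_in (S : pred C) : Prop :=
  forall (f : 'I_n -> 'I_n -> C) (lam : C),
    Omega1 f -> (forall a, bd1 f a = 0) -> (exists a b, f a b != 0) ->
    (forall a b, uplap1 f a b = lam * f a b) -> S lam.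

End Ops.

Definition triABC (n : nat) (T : {set {set 'I_n}}) (A B C : {set 'I_n}) :
  {set {set 'I_n}} :=
  [set t in T | [exists a in A, exists b in B, exists c in C, t == [set a; b; c]]].

Definition is_partition3 (n : nat) (A B C : {set 'I_n}) : Prop :=
  [/\ A != set0, B != set0 & C != set0] /\
  [/\ A :&: B = set0, B :&: C = set0, A :&: C = set0
    & A :|: B :|: C = [set: 'I_n]].

(* Main.v *)
Require Import Defs.
From HB Require Import structures.
From mathcomp Require Import all_boot all_order all_algebra.
From mathcomp Require Import ring.
Set Implicit Arguments.
Unset Strict Implicit.
Unset Printing Implicit Defensive.
Import Order.TTheory GRing.Theory Num.Theory.
Local Open Scope ring_scope.

(* Weigh an oriented edge by [#|C|] from A to B, by [#|A|] from B to C and by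
   [#|B|] from C to A.  The coboundary of this 1-form [F] vanishes except on
   transversal triangles, where it is [n] up to sign, so its energy is
   [n^2 |T(A,B,C)|].  Subtracting the exact part of [F] leaves a cycle without
   changing the energy, which is thus at least [lambda_1] times
   [|F|^2 - |exact part|^2].  Writing the graph Laplacian as [k_0 (1 - J/n) + R]
   with [|R| <= mu_0], the expander mixing estimate bounds [|F|^2] from below;
   the [k_0]-terms cancel in the boundary of [F], so the exact part has squared
   norm at most [2 n^3 mu_0^2 / (k_0 - mu_0)].  If the right-hand side of the
   theorem is positive, then [mu_0 / (k_0 - mu_0) <= 9|A||B||C| / (10 n^3)], and
   the two error terms fit into [10/9 mu_0 n^3]. *)

(** * Self-adjoint operators on functions over a finite type *)

Section Dot.
Variables (K : numClosedFieldType) (I : finType).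
Implicit Types f g h u z : I -> K.

Definition dot f g : K := \sum_i f i * (g i)^*.

Lemma eq_dot f f' g g' : f =1 f' -> g =1 g' -> dot f g = dot f' g'.
Proof. by move=> ff gg; apply: eq_bigr => i _; rewrite ff gg. Qed.

Lemma dotC f g : dot f g = (dot g f)^*.
Proof.
rewrite rmorph_sum; apply: eq_bigr => i _.
by rewrite rmorphM /= conjCK mulrC.
Qed.

Lemma dotDl f g h : dot (fun i => f i + g i) h = dot f h + dot g h.
Proof. by rewrite -big_split; apply: eq_bigr => i _; rewrite mulrDl. Qed.

Lemma dotDr f g h : dot h (fun i => f i + g i) = dot h f + dot h g.
Proof. by rewrite -big_split; apply: eq_bigr => i _; rewrite rmorphD mulrDr. Qed.

Lemma dotZl c f g : dot (fun i => c * f i) g = c * dot f g.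
Proof. by rewrite mulr_sumr; apply: eq_bigr => i _; rewrite mulrA. Qed.

Lemma dotZr c f g : dot f (fun i => c * g i) = c^* * dot f g.
Proof. by rewrite mulr_sumr; apply: eq_bigr => i _; rewrite rmorphM mulrCA. Qed.

Lemma dotBl f g h : dot (fun i => f i - g i) h = dot f h - dot g h.
Proof.
by rewrite -sumrB; apply: eq_bigr => i _; rewrite mulrBl.
Qed.

Lemma dotBr f g h : dot h (fun i => f i - g i) = dot h f - dot h g.
Proof.
by rewrite -sumrB; apply: eq_bigr => i _; rewrite rmorphB mulrBr.
Qed.

Lemma dot_suml (J : finType) (F : J -> I -> K) g :
  dot (fun i => \sum_j F j i) g = \sum_j dot (F j) g.
Proof. by rewrite exchange_big; apply: eq_bigr => i _; rewrite mulr_suml. Qed.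

Lemma dot_ge0 f : 0 <= dot f f.
Proof. by apply: sumr_ge0 => i _; apply: mul_conjC_ge0. Qed.

Lemma dot_eq0 f : dot f f = 0 -> forall i, f i = 0.
Proof.
move/eqP; rewrite psumr_eq0 => [/allP f0 i|i _]; last exact: mul_conjC_ge0.
by have := f0 i (mem_index_enum i); rewrite mul_conjC_eq0 => /eqP.
Qed.

Definition single (i : I) : I -> K := fun j => (j == i)%:R.

Lemma dot_singler f i : dot f (single i) = f i.
Proof.
rewrite /dot (bigD1 i) //= /single eqxx conjC1 mulr1 big1 ?addr0 // => j /negPf ->.
by rewrite conjC0 mulr0.
Qed.

Lemma dot_singlel f i : dot (single i) f = (f i)^*.
Proof. by rewrite dotC dot_singler. Qed.

Definition selfadjoint (L : (I -> K) -> I -> K) :=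
  forall f g, dot (L f) g = dot f (L g).

(* Self-adjointness alone forces linearity: [L f i = dot f (L (single i))]. *)
Lemma selfadjointE {L} : selfadjoint L -> forall f i, L f i = dot f (L (single i)).
Proof. by move=> sL f i; rewrite -sL dot_singler. Qed.

(** In the basis of the functions [single i], [L] is a hermitian matrix acting on row vectors, so
    the rows of the diagonalizing unitary matrix are eigenfunctions. Completeness is recorded as
    Parseval's identity, the form in which it is applied later. *)
Lemma selfadjoint_eigenbasis L : selfadjoint L ->
  exists (u : 'I_#|I| -> I -> K) (d : 'I_#|I| -> K),
    (forall k i, L (u k) i = d k * u k i) /\
    (forall f g, dot f g = \sum_k dot f (u k) * (dot g (u k))^*).
Proof.
move=> sL; pose m := #|I|.
pose A : 'M[K]_m := \matrix_(i, j) L (single (enum_val i)) (enum_val j).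
have Aherm : A \is hermsymmx.
  apply/is_hermitianmxP; rewrite expr0 scale1r; apply/matrixP => i j.
  by rewrite !mxE -dot_singler sL dot_singlel.
have /hermitian_normalmx/orthomx_spectralP := Aherm.
set P := spectralmx A; set s := spectral_diag A => Aeq.
have Pu : P \is unitarymx := spectral_unitarymx A.
have PP : forall i j, \sum_k P k i * (P k j)^* = (i == j)%:R.
  move=> i j; have : (P^t* *m P)%sesqui = 1%:M.
    by rewrite -invmx_unitary // mulVmx // unitarymx_unit.
  move/matrixP/(_ j i); rewrite !mxE eq_sym => <-.
  by apply: eq_bigr => k _; rewrite !mxE mulrC.
have PA : P *m A = diag_mx s *m P.
  by rewrite [A in LHS]Aeq !mulmxA mulmxV ?mul1mx // unitarymx_unit.
exists (fun k i => (P k (enum_rank i))), (fun k => s 0 k); split.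
  move=> k i; rewrite (selfadjointE sL).
  have /matrixP/(_ k (enum_rank i)) := PA.
  rewrite mul_diag_mx !mxE => <-; rewrite /dot.
  rewrite (reindex (fun j : 'I_m => enum_val j)) /=; last first.
    by exists enum_rank => ? _; rewrite ?enum_valK ?enum_rankK.
  apply: eq_bigr => j _; rewrite enum_valK; congr (_ * _).
  by rewrite !mxE enum_rankK -[RHS]dot_singler sL dot_singlel.
move=> f g.
transitivity (\sum_i \sum_j f i * (g j)^* * (i == j)%:R).
  apply: eq_bigr => i _; rewrite (bigD1 i) //= eqxx mulr1 big1 ?addr0 // => j.
  by rewrite eq_sym => /negPf ->; rewrite mulr0.
(* Orthonormality of the columns of [P] expands the Kronecker delta. *)
transitivity (\sum_i \sum_j \sum_k
   (f i * (P k (enum_rank i))^*) * ((g j)^* * P k (enum_rank j))).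
  apply: eq_bigr => i _; apply: eq_bigr => j _.
  rewrite -(can_eq (@enum_rankK I)) eq_sym -PP mulr_sumr.
  by apply: eq_bigr => k _; ring.
under eq_bigr => i _ do rewrite exchange_big.
rewrite exchange_big; apply: eq_bigr => k _.
rewrite rmorph_sum /= mulr_suml; apply: eq_bigr => i _.
rewrite -mulr_sumr; congr (_ * _); apply: eq_bigr => j _.
by rewrite rmorphM /= conjCK.
Qed.

Lemma selfadjoint_surjective L : selfadjoint L ->
  (forall u, (forall i, L u i = 0) -> forall i, u i = 0) ->
  forall h, exists g, forall i, L g i = h i.
Proof.
move=> sL injL h; have [u [d [ud pars]]] := selfadjoint_eigenbasis sL.
exists (fun i => \sum_k dot h (u k) / d k * u k i) => i.
rewrite (selfadjointE sL) dot_suml -[RHS]dot_singler pars.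
apply: eq_bigr => k _; rewrite dotZl -sL dot_singler ud dot_singlel conjCK.
(* Division by zero yields [0], but injectivity makes [u k] vanish when [d k] does, so the expansion
   loses no term. *)
have [d0|dn0] := eqVneq (d k) 0; last by rewrite mulrA divfK.
have -> : u k i = 0 by apply: injL => j; rewrite ud d0 mul0r.
by rewrite !mulr0.
Qed.

(* [W] is an invariant subspace, presented by the images [w] of the
   eigenvectors [u] under the orthogonal projection onto [W]. *)
Lemma spectral_measure L (W : (I -> K) -> Prop) : selfadjoint L ->
  (forall u d, (forall i, L u i = d * u i) -> exists w,
     [/\ W w, forall i, L w i = d * w i & forall z, W z -> dot z u = dot z w]) ->
  forall z, W z -> exists (p d : 'I_#|I| -> K),
    [/\ forall k, 0 <= p k, dot z z = \sum_k p k,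
        dot (L z) z = \sum_k d k * p k
      & forall k, p k != 0 -> exists w,
          [/\ W w, exists i, w i != 0 & forall i, L w i = d k * w i]].
Proof.
move=> sL proj z Wz; have [u [d [ud pars]]] := selfadjoint_eigenbasis sL.
exists (fun k => dot z (u k) * (dot z (u k))^*), d; split.
- by move=> k; apply: mul_conjC_ge0.
- exact: pars.
- rewrite sL pars; apply: eq_bigr => k _.
  rewrite sL (eq_dot (g' := fun i => d k * u k i) (frefl z) (ud k)) dotZr.
  by rewrite rmorphM /= conjCK; ring.
move=> k; rewrite mul_conjC_eq0.
have [w [Ww wd zw]] := proj _ _ (ud k); rewrite zw // => zwn0.
(* If the projection [w] were zero, so would be [dot z w], and the weight [p k] with it. *)
exists w; split => //; apply/existsP; apply: contraNT zwn0 => /existsPn w0.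
apply/eqP/big1 => i _; have := w0 i; rewrite negbK => /eqP ->.
by rewrite conjC0 mulr0.
Qed.

(** The form [dot (L z) z] is a sum of eigenvalues with nonnegative weights of total [dot z z].
    Eigenvalues of positive weight have an eigenvector in [W], so the bound applies to them. *)
Lemma rayleigh_ge L (W : (I -> K) -> Prop) c : selfadjoint L ->
  (forall u d, (forall i, L u i = d * u i) -> exists w,
     [/\ W w, forall i, L w i = d * w i & forall z, W z -> dot z u = dot z w]) ->
  (forall w d, W w -> (exists i, w i != 0) ->
     (forall i, L w i = d * w i) -> c <= d) ->
  forall z, W z -> c * dot z z <= dot (L z) z.
Proof.
move=> sL proj cd z Wz; have [p [d [p0 -> -> pd]]] := spectral_measure sL proj Wz.
rewrite mulr_sumr; apply: ler_sum => k _.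
have [->|/pd[w [Ww wn0 Lw]]] := eqVneq (p k) 0; first by rewrite !mulr0.
by apply: ler_wpM2r => //; apply: cd Lw.
Qed.

Lemma rayleigh_le L (W : (I -> K) -> Prop) c : selfadjoint L ->
  (forall u d, (forall i, L u i = d * u i) -> exists w,
     [/\ W w, forall i, L w i = d * w i & forall z, W z -> dot z u = dot z w]) ->
  (forall w d, W w -> (exists i, w i != 0) ->
     (forall i, L w i = d * w i) -> d <= c) ->
  forall z, W z -> dot (L z) z <= c * dot z z.
Proof.
move=> sL proj cd z Wz; have [p [d [p0 -> -> pd]]] := spectral_measure sL proj Wz.
rewrite mulr_sumr; apply: ler_sum => k _.
have [->|/pd[w [Ww wn0 Lw]]] := eqVneq (p k) 0; first by rewrite !mulr0.
by apply: ler_wpM2r => //; apply: cd Lw.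
Qed.

(** * Norm of a self-adjoint operator from its numerical range *)

Section NumericalRadius.
Variables (L : (I -> K) -> I -> K) (mu : K).
Hypothesis sL : selfadjoint L.
Hypothesis Lbound : forall u, - mu * dot u u <= dot (L u) u <= mu * dot u u.

Lemma selfadjointD u v i : L (fun j => u j + v j) i = L u i + L v i.
Proof. by rewrite !(selfadjointE sL) dotDl. Qed.

Lemma selfadjointB u v i : L (fun j => u j - v j) i = L u i - L v i.
Proof. by rewrite !(selfadjointE sL) dotBl. Qed.

Lemma selfadjointZ c u i : L (fun j => c * u j) i = c * L u i.
Proof. by rewrite !(selfadjointE sL) dotZl. Qed.

(** Subtract the lower bound at [u - v] from the upper bound at [u + v]: the diagonal terms cancel
    on the left, the cross terms on the right, and a factor 2 drops out. *)
Lemma polarization_le u v :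
  dot (L u) v + dot (L v) u <= mu * (dot u u + dot v v).
Proof.
have /andP[_ hi] := Lbound (fun i => u i + v i).
have /andP[lo _] := Lbound (fun i => u i - v i).
have := lerD hi lo; rewrite -subr_ge0 => h.
rewrite -subr_ge0 -(pmulr_lge0 _ (ltr0Sn K 1)); move: h.
rewrite (eq_dot (selfadjointD u v) (frefl _)) (eq_dot (selfadjointB u v) (frefl _)).
rewrite !(dotBl, dotBr, dotDl, dotDr).
by congr (0 <= _); ring.
Qed.

(** Polarization at [mu * u] and [L u] gives [2 mu |L u|^2 <= mu (mu^2 |u|^2 + |L u|^2)]; one factor
    [mu] is then cancelled, so [mu = 0] is treated apart. *)
Lemma selfadjoint_norm_le u : 0 <= mu -> dot (L u) (L u) <= mu ^+ 2 * dot u u.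
Proof.
move=> mu0; have [mu_eq0|mun0] := eqVneq mu 0.
  have := polarization_le u (L u).
  rewrite (sL (L u) u) mu_eq0 mul0r expr0n mul0r -mulr2n => h.
  by rewrite pmulrn_lle0 in h.
have mup : 0 < mu by rewrite lt_neqAle eq_sym mun0.
have := polarization_le (fun i => mu * u i) (L u).
rewrite (eq_dot (selfadjointZ mu u) (frefl _)) !(dotZl, dotZr).
rewrite (sL (L u) u) (CrealP (ger0_real mu0)) -subr_ge0 => h.
rewrite -subr_ge0 -(pmulr_rge0 _ mup); move: h; congr (0 <= _).
by ring.
Qed.

End NumericalRadius.
End Dot.

(** * The graph Laplacian *)

Section Level0.
Variables (K : numClosedFieldType) (n : nat) (E : {set {set 'I_n}}).
Implicit Types f g h u : 'I_n -> K.

Definition adj (x y : 'I_n) : K := ([set x; y] \in E)%:R.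

Lemma adjC x y : adj x y = adj y x.
Proof. by rewrite /adj setUC. Qed.

Lemma adj_conj x y : (adj x y)^* = adj x y.
Proof. exact: conjC_nat. Qed.

Lemma adj_idem x y : adj x y * adj x y = adj x y.
Proof. by rewrite /adj; case: (_ \in _); rewrite ?mulr0 ?mulr1. Qed.

Lemma bd1E (F : 'I_n -> 'I_n -> K) a : bd1 E F a = \sum_v adj v a * F v a.
Proof.
rewrite /bd1 big_mkcond; apply: eq_bigr => v _.
by rewrite /adj; case: (_ \in _); rewrite ?mul1r ?mul0r.
Qed.

Lemma uplap0E f a : uplap0 E f a = \sum_v adj v a * (f a - f v).
Proof. exact: bd1E. Qed.

Lemma uplap0_selfadjoint : selfadjoint (uplap0 E : ('I_n -> K) -> _).
Proof.
move=> f g; transitivity (\sum_a \sum_v adj v a * (f a * (g a)^*)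
                          - \sum_a \sum_v adj v a * (f v * (g a)^*)).
  rewrite -sumrB; apply: eq_bigr => a _; rewrite uplap0E mulr_suml -sumrB.
  by apply: eq_bigr => v _; ring.
rewrite [X in _ - X]exchange_big -sumrB; apply: eq_bigr => a _.
rewrite uplap0E rmorph_sum /= mulr_sumr -sumrB; apply: eq_bigr => v _.
by rewrite rmorphM rmorphB /= adj_conj [adj a v]adjC; ring.
Qed.

Lemma uplap0Bconst f c : uplap0 E (fun a => f a - c) =1 uplap0 E f.
Proof. by move=> a; rewrite !uplap0E; apply: eq_bigr => v _; congr (_ * _); ring. Qed.

Lemma bd0_dot f : bd0 f = dot f (fun=> 1).
Proof. by apply: eq_bigr => a _; rewrite conjC1 mulr1. Qed.

Lemma dot_constr f c : dot f (fun=> c) = bd0 f * c^*.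
Proof. by rewrite mulr_suml. Qed.

Lemma bd0_uplap0 f : bd0 (uplap0 E f) = 0.
Proof.
rewrite bd0_dot uplap0_selfadjoint; apply: big1 => a _.
by rewrite uplap0E big1 ?conjC0 ?mulr0 // => v _; rewrite subrr mulr0.
Qed.

Lemma bd0D f g : bd0 (fun a => f a + g a) = bd0 f + bd0 g.
Proof. exact: big_split. Qed.

Lemma bd0B f g : bd0 (fun a => f a - g a) = bd0 f - bd0 g.
Proof. exact: sumrB. Qed.

Lemma bd0Z c f : bd0 (fun a => c * f a) = c * bd0 f.
Proof. by rewrite mulr_sumr. Qed.

Lemma bd0_const c : bd0 (fun _ : 'I_n => c : K) = n%:R * c.
Proof. by rewrite /bd0 sumr_const card_ord mulr_natl. Qed.

Hypothesis n_gt0 : (0 < n)%N.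

Let n_neq0 : n%:R != 0 :> K.
Proof. by rewrite pnatr_eq0 -lt0n. Qed.

Definition mean f : K := bd0 f / n%:R.
Definition center f : 'I_n -> K := fun a => f a - mean f.

Lemma bd0_center f : bd0 (center f) = 0.
Proof. by rewrite /center bd0B bd0_const mulrC divfK ?subrr. Qed.

(** Centering preserves the eigenvalue equation: the Laplacian kills constants, and its values sum
    to zero, which forces [d * mean u = 0]. *)
Lemma uplap0_projection u d : (forall a, uplap0 E u a = d * u a) ->
  exists w, [/\ bd0 w = 0, forall a, uplap0 E w a = d * w a
    & forall z, bd0 z = 0 -> dot z u = dot z w].
Proof.
move=> ud; exists (center u); split; first exact: bd0_center.
- move=> a; rewrite uplap0Bconst ud /center mulrBr.
  have : bd0 (uplap0 E u) = d * bd0 u.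
    by rewrite -bd0Z; apply: eq_bigr => b _; exact: ud.
  by rewrite bd0_uplap0 /mean mulrA => <-; rewrite mul0r subr0.
- by move=> z z0; rewrite /center dotBr dot_constr z0 mul0r subr0.
Qed.

Variables k0 mu : K.
Hypothesis spec0 : nontriv_spec0_in E (fun x => (k0 - mu <= x) && (x <= k0 + mu)).

Lemma uplap0_ge f : bd0 f = 0 -> (k0 - mu) * dot f f <= dot (uplap0 E f) f.
Proof.
apply: (rayleigh_ge (W := fun w => bd0 w = 0) uplap0_selfadjoint uplap0_projection).
by move=> w d w0 wn0 /(spec0 w0 wn0)/andP[].
Qed.

Lemma uplap0_le f : bd0 f = 0 -> dot (uplap0 E f) f <= (k0 + mu) * dot f f.
Proof.
apply: (rayleigh_le (W := fun w => bd0 w = 0) uplap0_selfadjoint uplap0_projection).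
by move=> w d w0 wn0 /(spec0 w0 wn0)/andP[].
Qed.

(** Adding the all-ones operator [bd0] to the Laplacian makes it injective: the sum of the values is
    multiplied by [n], so a kernel element has zero sum, and there the spectral gap applies. The
    same sum identity shows that the solution has zero sum, where the added term disappears. *)
Lemma uplap0_solve h : 0 < k0 - mu -> bd0 h = 0 ->
  exists2 g, bd0 g = 0 & forall a, uplap0 E g a = h a.
Proof.
move=> kappa_gt0 h0.
have sLJ : selfadjoint (fun f a => uplap0 E f a + bd0 f).
  move=> f g; rewrite dotDl dotDr uplap0_selfadjoint; congr (_ + _).
  by rewrite dotC !dot_constr rmorphM /= conjCK mulrC.
have bd0LJ f : bd0 (fun a => uplap0 E f a + bd0 f) = n%:R * bd0 f.
  by rewrite bd0D bd0_uplap0 add0r bd0_const.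
have injLJ u : (forall a, uplap0 E u a + bd0 u = 0) -> forall a, u a = 0.
  move=> u0; have bu0 : bd0 u = 0.
    apply/eqP; rewrite -(mulrI_eq0 _ (mulfI n_neq0)) -bd0LJ.
    by apply/eqP/big1 => a _; apply: u0.
  apply: dot_eq0; apply/eqP; rewrite eq_le dot_ge0 andbT.
  rewrite -(pmulr_rle0 _ kappa_gt0); apply: le_trans (uplap0_ge bu0) _.
  rewrite /dot big1 // => a _; have := u0 a; rewrite bu0 addr0 => ->.
  by rewrite mul0r.
have [g gh] := selfadjoint_surjective sLJ injLJ h.
have g0 : bd0 g = 0.
  apply/eqP; rewrite -(mulrI_eq0 _ (mulfI n_neq0)) -bd0LJ -h0.
  by apply/eqP/eq_bigr => a _; apply: gh.
by exists g => // a; rewrite -gh g0 addr0.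
Qed.

(** The remainder [R] after removing the Laplacian of an ideal expander, [k0 (1 - J/n)]; it also
    kills constants. *)
Definition deviation f : 'I_n -> K := fun a => uplap0 E f a - k0 * center f a.

Lemma deviation_selfadjoint : k0 \is Num.real -> selfadjoint deviation.
Proof.
move=> /CrealP k0r f g; rewrite dotBl dotBr uplap0_selfadjoint dotZl dotZr k0r.
congr (_ - _ * _); rewrite dotBl dotBr; congr (_ - _).
rewrite dotC !dot_constr /mean rmorphM /= conjCK rmorphM /= fmorphV /= conjC_nat.
by ring.
Qed.

Lemma dot_center f : dot (center f) f = dot (center f) (center f).
Proof. by rewrite [in RHS]/center dotBr dot_constr bd0_center mul0r subr0. Qed.

Lemma dot_center_le f : dot (center f) (center f) <= dot f f.
Proof.
have -> : dot f f = dot (center f) (center f) + mean f * (mean f)^* * n%:R.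
  rewrite -dot_center dotBl (dotC (fun=> mean f) f) dot_constr -addrA.
  rewrite rmorphM /= conjCK /mean rmorphM /= fmorphV /= conjC_nat.
  by field.
by rewrite lerDl mulr_ge0 ?mul_conjC_ge0 ?ler0n.
Qed.

Lemma dot_deviation f : dot (deviation f) f =
  dot (uplap0 E (center f)) (center f) - k0 * dot (center f) (center f).
Proof.
rewrite dotBl dotZl dot_center; congr (_ - _).
rewrite (eq_dot (uplap0Bconst f (mean f)) (frefl _)) [in RHS]/center dotBr.
by rewrite dot_constr bd0_uplap0 mul0r subr0.
Qed.

(** Only the centered part of [f] matters, and centering does not increase the norm; this extends
    the spectral bound from zero-sum functions to all functions. *)
Lemma deviation_bound f : 0 <= mu ->
  - mu * dot f f <= dot (deviation f) f <= mu * dot f f.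
Proof.
move=> mu0; rewrite dot_deviation.
have c0 := bd0_center f; have cle := ler_wpM2l mu0 (dot_center_le f).
apply/andP; split.
  rewrite lerBrDr; apply: le_trans (uplap0_ge c0).
  by rewrite mulrBl addrC lerD2l mulNr lerN2.
rewrite lerBlDr; apply: le_trans (uplap0_le c0) _.
by rewrite mulrDl addrC lerD2r.
Qed.

Lemma dot_deviation_le f : k0 \is Num.real -> 0 <= mu ->
  dot (deviation f) (deviation f) <= mu ^+ 2 * dot f f.
Proof.
move=> k0r mu0; apply: selfadjoint_norm_le => //; first exact: deviation_selfadjoint.
by move=> u; apply: deviation_bound.
Qed.

End Level0.

(** * The upper Laplacian on edges *)

Section Level1.
Variables (K : numClosedFieldType) (n : nat) (E T : {set {set 'I_n}}).
Implicit Types F G : 'I_n * 'I_n -> K.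
Implicit Types g h : 'I_n -> K.

Local Notation w := (adj K E).

Definition tri (x y z : 'I_n) : K := ([set x; y; z] \in T)%:R.

Lemma triC x y z : tri x y z = tri y x z.
Proof. by rewrite /tri [[set x; y]]setUC. Qed.

Lemma triAC x y z : tri x y z = tri x z y.
Proof. by rewrite /tri setUAC. Qed.

Lemma tri_conj x y z : (tri x y z)^* = tri x y z.
Proof. exact: conjC_nat. Qed.

Hypothesis ETc : is_triangle_complex E T.

(** Members of [T] have three elements, so [tri] vanishes on triples with a repetition, and the pair
    really is a two-element face. *)
Lemma tri_adj x y z : tri x y z * w y z = tri x y z.
Proof.
rewrite /tri /adj; have [t|_] := boolP (_ \in T); last by rewrite mul0r.
case: ETc => _ T3 TE _; rewrite (TE _ _ t) ?mulr1 //.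
  by rewrite -setUA subsetUr.
have := T3 _ t; rewrite cards2 -setUA cardsU1 cards2.
by case: (y != z); case: (_ \notin _).
Qed.

Lemma tri_adjl x y z : tri x y z * w x z = tri x y z.
Proof. by rewrite triC tri_adj. Qed.

Lemma tri_adjr x y z : tri x y z * w y x = tri x y z.
Proof. by rewrite triAC triC adjC tri_adj. Qed.

Lemma dot_pair F G : dot F G = \sum_a \sum_b F (a, b) * (G (a, b))^*.
Proof. by rewrite pair_bigA; apply: eq_bigr => -[]. Qed.

(* On skew-symmetric functions this is the upper Laplacian; on all functions of
   ordered pairs it is, unlike [uplap1], self-adjoint. *)
Definition lap1 F : 'I_n * 'I_n -> K :=
  fun p => \sum_v tri v p.1 p.2 * (F p - F (v, p.2) - F (p.1, v)).

(** The degree term is diagonal. In each of the other two, exchanging [v] with the vertex it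
    replaces swaps the roles of [F] and [G], because [tri] is symmetric. *)
Lemma lap1_selfadjoint : selfadjoint lap1.
Proof.
move=> F G; rewrite !dot_pair.
transitivity (\sum_a \sum_b \sum_v tri v a b * (F (a, b) * (G (a, b))^*)
  - \sum_a \sum_b \sum_v tri v a b * (F (v, b) * (G (a, b))^*)
  - \sum_a \sum_b \sum_v tri v a b * (F (a, v) * (G (a, b))^*)).
  rewrite -!sumrB; apply: eq_bigr => a _; rewrite -!sumrB; apply: eq_bigr => b _.
  rewrite mulr_suml -!sumrB; apply: eq_bigr => v _ /=; ring.
transitivity (\sum_a \sum_b \sum_v tri v a b * (F (a, b) * (G (a, b))^*)
  - \sum_a \sum_b \sum_v tri v a b * (F (a, b) * (G (v, b))^*)
  - \sum_a \sum_b \sum_v tri v a b * (F (a, b) * (G (a, v))^*)).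
  congr (_ - _ - _).
    rewrite exchange_big [RHS]exchange_big; apply: eq_bigr => b _.
    rewrite exchange_big; apply: eq_bigr => a _; apply: eq_bigr => v _.
    by rewrite triC.
  apply: eq_bigr => a _; rewrite exchange_big; apply: eq_bigr => b _.
  by apply: eq_bigr => v _; rewrite triC triAC triC.
rewrite -!sumrB; apply: eq_bigr => a _; rewrite -!sumrB; apply: eq_bigr => b _.
rewrite rmorph_sum mulr_sumr -!sumrB; apply: eq_bigr => v _ /=.
by rewrite rmorphM !rmorphB /= tri_conj; ring.
Qed.

Lemma lap1_supp F a b : w a b * lap1 F (a, b) = lap1 F (a, b).
Proof.
rewrite mulr_sumr; apply: eq_bigr => v _ /=.
by rewrite mulrA [w a b * _]mulrC tri_adj.
Qed.

(** Wherever [tri] is nonzero, the pairs at which [F] is evaluated are edges of a triangle. Cut-offs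
    to edges can therefore be dropped inside [lap1]. *)
Lemma lap1_restrict F p : lap1 (fun q => w q.1 q.2 * F q) p = lap1 F p.
Proof.
case: p => a b; apply: eq_bigr => v _ /=.
rewrite -[in LHS](tri_adj v a b); have := tri_adj v a b.
have := tri_adjl v a b; have := tri_adjr v a b.
move=> h1 h2 h3; rewrite !mulrBr !mulrA.
have -> : tri v a b * w a b * w v b = tri v a b by rewrite h3 h2.
have -> : tri v a b * w a b * w a v = tri v a b by rewrite h3 h1.
by rewrite !h3.
Qed.

Definition gradient g : 'I_n * 'I_n -> K := fun p => w p.1 p.2 * (g p.2 - g p.1).

Lemma lap1_gradient g p : lap1 (gradient g) p = 0.
Proof.
rewrite (lap1_restrict (fun q => g q.2 - g q.1)); apply: big1 => v _ /=.
by rewrite (_ : _ - _ = 0) ?mulr0 //; ring.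
Qed.

Local Notation curry F := (fun a b => F (a, b)).

Lemma lap1_uplap1 F a b : Omega1 E (curry F) ->
  uplap1 T (curry F) a b = lap1 F (a, b).
Proof.
move=> [skew _]; rewrite /uplap1 /bd2 big_mkcond; apply: eq_bigr => v _.
rewrite /tri /delta2 /= (skew v a); case: (_ \in _); rewrite ?mul1r ?mul0r //.
Qed.

Lemma Omega1_adj F a b : Omega1 E (curry F) -> w a b * F (a, b) = F (a, b).
Proof.
move=> [_ F0]; rewrite /adj; have [|/F0 ->] := boolP (_ \in E).
  by rewrite mul1r.
by rewrite mulr0.
Qed.

(* Each unoriented edge is counted twice by [dot]. *)
Lemma dot_gradient F g : Omega1 E (curry F) ->
  dot F (gradient g) = 2 * dot (bd1 E (curry F)) g.
Proof.
move=> OF; have [skew F0] := OF; rewrite dot_pair.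
transitivity (\sum_a \sum_b w a b * F (a, b) * (g b)^*
              - \sum_a \sum_b w a b * F (a, b) * (g a)^*).
  rewrite -sumrB; apply: eq_bigr => a _; rewrite -sumrB; apply: eq_bigr => b _.
  by rewrite rmorphM rmorphB /= adj_conj; ring.
rewrite exchange_big -sumrB mulr_sumr; apply: eq_bigr => a _.
rewrite bd1E mulr_suml mulr_sumr -sumrB; apply: eq_bigr => b _.
by rewrite (skew a b) (adjC K E a b); ring.
Qed.

Lemma Omega1_gradient g : Omega1 E (curry (gradient g)).
Proof.
split=> a b; rewrite /gradient /=; first by rewrite (adjC K E b a); ring.
by rewrite /adj => /negPf ->; rewrite mul0r.
Qed.

Lemma Omega1B F G : Omega1 E (curry F) -> Omega1 E (curry G) ->
  Omega1 E (curry (fun p => F p - G p)).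
Proof.
move=> [sF F0] [sG G0]; split=> a b; first by rewrite (sF a b) (sG a b); ring.
by move=> ab; rewrite F0 // G0 // subrr.
Qed.

Lemma bd1_gradient g a : bd1 E (curry (gradient g)) a = uplap0 E g a.
Proof. by rewrite bd1E uplap0E; apply: eq_bigr => v _; rewrite mulrA adj_idem. Qed.

Lemma bd1B F G a :
  bd1 E (curry (fun p => F p - G p)) a = bd1 E (curry F) a - bd1 E (curry G) a.
Proof. exact: sumrB. Qed.

Lemma bd0_bd1 F : Omega1 E (curry F) -> bd0 (bd1 E (curry F)) = 0.
Proof.
move=> OF; have := dot_gradient (fun=> 1) OF.
rewrite -bd0_dot [LHS]big1 => [/esym/eqP|p _]; last first.
  by rewrite /gradient subrr mulr0 conjC0 mulr0.
by rewrite mulf_eq0 pnatr_eq0 => /eqP.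
Qed.

(** By duality: pair with the gradient of [single a] and move [lap1] onto that gradient, which it
    kills. *)
Lemma bd1_lap1 F a : Omega1 E (curry (lap1 F)) -> bd1 E (curry (lap1 F)) a = 0.
Proof.
move=> OL; have := dot_gradient (single K a) OL; rewrite dot_singler lap1_selfadjoint.
rewrite [LHS]big1 => [/esym/eqP|p _]; last by rewrite lap1_gradient conjC0 mulr0.
by rewrite mulf_eq0 pnatr_eq0 => /eqP.
Qed.

(** * Hodge decomposition and the spectral gap on cycles *)

Hypothesis n_gt0 : (0 < n)%N.
Variables k0 mu lam : K.
Hypothesis spec0 : nontriv_spec0_in E (fun x => (k0 - mu <= x) && (x <= k0 + mu)).
Hypothesis kappa_gt0 : 0 < k0 - mu.
Hypothesis spec1 : nontriv_spec1_in E T (fun x => lam <= x).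

Definition cycle1 F := Omega1 E (curry F) /\ forall a, bd1 E (curry F) a = 0.

Lemma dot_cycle1_gradient z g : cycle1 z -> dot z (gradient g) = 0.
Proof.
move=> [Oz z0]; rewrite dot_gradient // [dot _ _]big1 ?mulr0 // => a _.
by rewrite z0 mul0r.
Qed.

(** The potential [g] of the exact part solves a Poisson equation, solvable since a boundary has
    zero sum. *)
Lemma hodge F : Omega1 E (curry F) -> exists2 g, bd0 g = 0 &
  (forall a, uplap0 E g a = bd1 E (curry F) a) /\
  cycle1 (fun p => F p - gradient g p).
Proof.
move=> OF; have [g g0 gF] := uplap0_solve n_gt0 spec0 kappa_gt0 (bd0_bd1 OF).
exists g => //; split=> //; split; first exact: Omega1B OF (Omega1_gradient g).
by move=> a; rewrite bd1B bd1_gradient gF subrr.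
Qed.

Lemma lap1B F G p : lap1 (fun q => F q - G q) p = lap1 F p - lap1 G p.
Proof. exact: selfadjointB lap1_selfadjoint _ _ _. Qed.

(** The projection onto cycles is taken in two stages: antisymmetrize and cut off to edges, giving
    [s] in [Omega1], then subtract the exact part of [s]. *)
Lemma lap1_projection u d : (forall p, lap1 u p = d * u p) ->
  exists c, [/\ cycle1 c, forall p, lap1 c p = d * c p
    & forall z, cycle1 z -> dot z u = dot z c].
Proof.
move=> ud.
pose s : 'I_n * 'I_n -> K := fun p => w p.1 p.2 * (2^-1 * (u p - u (p.2, p.1))).
have Os : Omega1 E (curry s).
  split=> a b; rewrite /s /=; first by rewrite (adjC K E b a); ring.
  by rewrite /adj => /negPf ->; rewrite mul0r.
have swapL F a b : lap1 (fun p => F (p.2, p.1)) (a, b) = lap1 F (b, a).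
  by apply: eq_bigr => v _ /=; rewrite triAC; ring.
have sd p : lap1 s p = d * s p.
  case: p => a b; rewrite /s lap1_restrict.
  rewrite (selfadjointZ lap1_selfadjoint) (selfadjointB lap1_selfadjoint).
  rewrite swapL -(lap1_supp u a b) -(lap1_supp u b a) !ud (adjC K E b a) /=.
  by ring.
have OLs : Omega1 E (curry (lap1 s)).
  have [s1 s0] := Os; split=> a b; rewrite !sd; first by rewrite s1 mulrN.
  by move=> /s0 ->; rewrite mulr0.
have [g g0 [gs cw]] := hodge Os.
exists (fun p => s p - gradient g p); split=> //.
  move=> p; rewrite lap1B lap1_gradient subr0 sd.
  (* If [d] is nonzero, [s] is a multiple of [lap1 s], hence already a cycle, and its exact part is
     zero. *)
  have [->|dn0] := eqVneq d 0; first by rewrite !mul0r.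
  suff /dot_eq0 -> : dot (gradient g) (gradient g) = 0 by rewrite subr0.
  rewrite (dot_gradient _ (Omega1_gradient g)) [dot _ _]big1 ?mulr0 // => a _.
  rewrite bd1_gradient gs; suff -> : bd1 E (curry s) a = 0 by rewrite mul0r.
  apply: (mulfI dn0); rewrite mulr0 -(bd1_lap1 a OLs) /bd1 mulr_sumr.
  by apply: eq_bigr => v _; rewrite sd.
move=> z cz; rewrite dotBr dot_cycle1_gradient // subr0.
have [Oz _] := cz; have [sz z0] := Oz.
transitivity (2^-1 * (dot z u - dot z (fun p => u (p.2, p.1)))).
  suff -> : dot z (fun p => u (p.2, p.1)) = - dot z u by field.
  rewrite !dot_pair exchange_big -sumrN; apply: eq_bigr => a _.
  by rewrite -sumrN; apply: eq_bigr => b _; rewrite sz mulNr.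
rewrite -dotBr mulr_sumr; apply: eq_bigr => -[a b] _ /=.
rewrite /s /= -(Omega1_adj a b Oz) !rmorphM !rmorphB /= adj_conj fmorphV /= conjC_nat.
have e := adj_idem K E a b; ring: e.
Qed.

Lemma lap1_ge z : cycle1 z -> lam * dot z z <= dot (lap1 z) z.
Proof.
apply: (rayleigh_ge lap1_selfadjoint lap1_projection).
move=> c d [Oc c0] [[a b] cn0] Lc.
apply: (spec1 Oc c0); first by exists a, b.
by move=> x y; rewrite lap1_uplap1.
Qed.

(* [q] is the squared norm of the exact part of [F]. *)
Lemma lap1_isoperimetric F : Omega1 E (curry F) -> exists q,
  (k0 - mu) * q <= dot (bd1 E (curry F)) (bd1 E (curry F)) /\
  lam * (dot F F - 2 * q) <= dot (lap1 F) F.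
Proof.
move=> OF; have [g g0 [gF cz]] := hodge OF.
pose z := fun p => F p - gradient g p; pose q := dot (uplap0 E g) g.
have gg : dot (gradient g) (gradient g) = 2 * q.
  rewrite (dot_gradient _ (Omega1_gradient g)); congr (_ * _).
  by apply: eq_dot => // a; rewrite bd1_gradient.
have Fz : forall p, F p = z p + gradient g p by move=> p; rewrite /z subrK.
exists q; split.
  set B := bd1 E _; set kap := k0 - mu.
  have kap_real : kap^* = kap by apply/CrealP/ger0_real/ltW.
  have Bg : dot B g = q by apply: eq_dot => // a; rewrite gF.
  have gB : dot g B = q.
    rewrite /q uplap0_selfadjoint; apply: eq_dot => // a; by rewrite gF.
  (* Expanding [|B - kap g|^2 >= 0] and adding [kap (q - kap |g|^2) >= 0] cancels [|g|^2] and leaves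
     [kap q <= |B|^2]. *)
  have := dot_ge0 (fun a => B a - kap * g a).
  rewrite dotBl !dotBr !dotZl !dotZr kap_real Bg gB => h.
  have := uplap0_ge n_gt0 spec0 g0; rewrite -/q -/kap -subr_ge0.
  move/(mulr_ge0 (ltW kappa_gt0)); rewrite -/kap => h2.
  rewrite -subr_ge0; move: (addr_ge0 h h2); congr (0 <= _); ring.
have -> : dot F F - 2 * q = dot z z.
  rewrite (eq_dot Fz Fz) (dotDl z) !(dotDr z) gg dot_cycle1_gradient //.
  by rewrite (dotC (gradient g) z) dot_cycle1_gradient // conjC0; ring.
suff -> : dot (lap1 F) F = dot (lap1 z) z by apply: lap1_ge.
have Lz p : lap1 F p = lap1 z p by rewrite lap1B lap1_gradient subr0.
rewrite (eq_dot Lz Fz) dotDr [X in _ + X]lap1_selfadjoint [X in _ + X]big1 ?addr0 // => p _.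
by rewrite lap1_gradient conjC0 mulr0.
Qed.

End Level1.

(** * The flow attached to a tripartition *)

(** Parallelogram law: [|a r - b s|^2] is at most [2 (a^2 |r|^2 + b^2 |s|^2)], the difference being
    [|a r + b s|^2]. *)
Lemma dist_norm_sqr_le (K : numClosedFieldType) (N a b r s : K) :
  0 <= a <= N -> 0 <= b <= N ->
  (a * r - b * s) * (a * r - b * s)^* <= 2 * N ^+ 2 * (r * r^* + s * s^*).
Proof.
move=> /andP[a0 aN] /andP[b0 bN].
have /CrealP ar : a \is Num.real by apply: ger0_real.
have /CrealP br : b \is Num.real by apply: ger0_real.
apply: (@le_trans _ _ (2 * (a ^+ 2 * (r * r^*) + b ^+ 2 * (s * s^*)))).
  rewrite -subr_ge0.
  have := mul_conjC_ge0 (a * r + b * s); congr (0 <= _).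
  by rewrite rmorphD rmorphB !rmorphM /= ar br; ring.
rewrite -mulrA ler_wpM2l ?ler0n // mulrDr lerD //.
  by apply: ler_wpM2r; [apply: mul_conjC_ge0 | rewrite lerXn2r ?nnegrE // (le_trans a0)].
by apply: ler_wpM2r; [apply: mul_conjC_ge0 | rewrite lerXn2r ?nnegrE // (le_trans b0)].
Qed.

Section TransversalFlow.
Variables (K : numClosedFieldType) (n : nat) (E T : {set {set 'I_n}}).
Variables A B C : {set 'I_n}.
Hypothesis ABC : is_partition3 A B C.

Local Notation w := (adj K E).

Definition ind (S : {set 'I_n}) : 'I_n -> K := fun x => (x \in S)%:R.

Lemma ind_conj S x : (ind S x)^* = ind S x.
Proof. exact: conjC_nat. Qed.

Lemma bd0_ind S : bd0 (ind S) = #|S|%:R.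
Proof.
rewrite /bd0 -sum1_card natr_sum [RHS]big_mkcond; apply: eq_bigr => x _.
by rewrite /ind; case: (_ \in _).
Qed.

Lemma dot_ind S : dot (ind S) (ind S) = #|S|%:R.
Proof.
rewrite -bd0_ind; apply: eq_bigr => x _; rewrite ind_conj /ind.
by case: (_ \in _); rewrite ?mulr1 ?mulr0.
Qed.

(** Case analysis on this predicate replaces all three indicator values at [x] by constants at once,
    leaving polynomial identities. *)
Variant part_spec x : K -> K -> K -> Prop :=
  | InA of x \in A : part_spec x 1 0 0
  | InB of x \in B : part_spec x 0 1 0
  | InC of x \in C : part_spec x 0 0 1.

Lemma partP x : part_spec x (ind A x) (ind B x) (ind C x).
Proof.
case: ABC => _ [/setP/(_ x) AB /setP/(_ x) BC /setP/(_ x) AC /setP/(_ x)].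
move: AB BC AC; rewrite !inE /ind.
case xA: (x \in A); case xB: (x \in B); case xC: (x \in C) => //= _ _ _ _.
- exact: InA.
- exact: InB.
- exact: InC.
Qed.

Local Notation a := (#|A|%:R : K).
Local Notation b := (#|B|%:R : K).
Local Notation c := (#|C|%:R : K).

Lemma natr_parts : n%:R = a + b + c.
Proof.
have -> : n%:R = bd0 (fun _ : 'I_n => 1 : K) by rewrite bd0_const mulr1.
rewrite -!bd0_ind -!bd0D; apply: eq_bigr => x _.
by case: (partP x) => _; ring.
Qed.

Let n_gt0 : (0 < n)%N.
Proof. by case: ABC => [[/set0Pn[x _] _ _] _]; apply: leq_ltn_trans (ltn_ord x). Qed.

Let n_neq0 : n%:R != 0 :> K.
Proof. by rewrite pnatr_eq0 -lt0n. Qed.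

Definition weight : 'I_n * 'I_n -> K := fun p =>
  c * (ind A p.1 * ind B p.2 - ind B p.1 * ind A p.2)
  + a * (ind B p.1 * ind C p.2 - ind C p.1 * ind B p.2)
  + b * (ind C p.1 * ind A p.2 - ind A p.1 * ind C p.2).

Definition flow : 'I_n * 'I_n -> K := fun p => w p.1 p.2 * weight p.

Lemma Omega1_flow : Omega1 E (fun x y => flow (x, y)).
Proof.
split=> x y; rewrite /flow /weight /=; first by rewrite (adjC K E y x); ring.
by rewrite /adj => /negPf ->; rewrite mul0r.
Qed.

Definition edges (S S' : {set 'I_n}) : K :=
  \sum_x \sum_y w x y * (ind S x * ind S' y).

Lemma dot_flow : dot flow flow = c ^+ 2 * (edges A B + edges B A)
  + a ^+ 2 * (edges B C + edges C B) + b ^+ 2 * (edges C A + edges A C).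
Proof.
rewrite dot_pair /edges -!big_split !mulr_sumr -!big_split; apply: eq_bigr => x _ /=.
rewrite -!big_split !mulr_sumr -!big_split; apply: eq_bigr => y _ /=.
rewrite /flow /weight /= !(rmorphM, rmorphD, rmorphB) /= adj_conj !ind_conj !conjC_nat.
have e := adj_idem K E x y.
by case: (partP x) => _; case: (partP y) => _; ring: e.
Qed.

Definition triangles (S S' S'' : {set 'I_n}) : K :=
  \sum_x \sum_y \sum_z tri K T x y z * (ind S x * ind S' y * ind S'' z).

Lemma trianglesC S S' S'' : triangles S S' S'' = triangles S' S S''.
Proof.
rewrite /triangles exchange_big; apply: eq_bigr => x _; apply: eq_bigr => y _.
by apply: eq_bigr => z _; rewrite triC [ind S _ * _]mulrC.
Qed.

Lemma trianglesAC S S' S'' : triangles S S' S'' = triangles S S'' S'.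
Proof.
apply: eq_bigr => x _; rewrite exchange_big; apply: eq_bigr => y _.
by apply: eq_bigr => z _; rewrite triAC mulrAC.
Qed.

(** Disjointness of the parts makes the map from ordered triples to vertex sets injective: each
    vertex is recognized by its part. *)
Lemma triangles_le : triangles A B C <= #|triABC T A B C|%:R.
Proof.
pose S := [set t : 'I_n * 'I_n * 'I_n |
  [&& [set t.1.1; t.1.2; t.2] \in T, t.1.1 \in A, t.1.2 \in B & t.2 \in C]].
pose m (t : 'I_n * 'I_n * 'I_n) := [set t.1.1; t.1.2; t.2].
have -> : triangles A B C = #|S|%:R.
  rewrite /triangles pair_bigA pair_bigA /= -sum1_card natr_sum [RHS]big_mkcond.
  apply: eq_bigr => -[[x y] z] _ /=; rewrite inE /tri /ind /=.
  by case: (_ \in T); case: (x \in A); case: (y \in B); case: (z \in C);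
    rewrite /= ?(mulr0, mul0r, mulr1).
have notin x : [/\ x \in A -> x \notin B, x \in B -> x \notin C
                 & x \in A -> x \notin C].
  case: ABC => _ [/setP/(_ x) AB /setP/(_ x) BC /setP/(_ x) AC _].
  by move: AB BC AC; rewrite !inE; case: (x \in A); case: (x \in B); case: (x \in C).
have minj : {in S &, injective m}.
  move=> [[x y] z] [[x' y'] z']; rewrite !inE /m /=.
  move=> /and4P[_ xA yB zC] /and4P[_ xA' yB' zC'] /setP e.
  have neq u v (P Q : {set 'I_n}) :
      (forall t, t \in P -> t \notin Q) -> u \in P -> v \in Q -> (u == v) = false.
    by move=> h uP vQ; apply/eqP => uv; move: (h u uP); rewrite uv vQ.
  have nAB t : t \in A -> t \notin B by case: (notin t).
  have nBC t : t \in B -> t \notin C by case: (notin t).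
  have nAC t : t \in A -> t \notin C by case: (notin t).
  congr (_, _, _).
  - have := e x; rewrite !inE eqxx (neq x y' _ _ nAB) // (neq x z' _ _ nAC) //.
    by rewrite !orbF => /esym/eqP.
  - have := e y; rewrite !inE eqxx orbT /= (neq y z' _ _ nBC) // orbF.
    by rewrite eq_sym (neq x' y _ _ nAB) // => /esym/eqP.
  - have := e z; rewrite !inE eqxx orbT /= eq_sym (neq x' z _ _ nAC) //.
    by rewrite eq_sym (neq y' z _ _ nBC) // => /esym/eqP.
rewrite ler_nat -(card_in_imset minj); apply/subset_leq_card/subsetP => t.
case/imsetP => -[[x y] z]; rewrite !inE /= => /and4P[tT xA yB zC] ->.
rewrite tT; apply/existsP; exists x; rewrite xA; apply/existsP; exists y.
by rewrite yB; apply/existsP; exists z; rewrite zC eqxx.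
Qed.

Hypothesis ETc : is_triangle_complex E T.

(** On a transversal triangle each ordered edge contributes [n] times its absolute weight; the six
    ordered edges carry [a], [b], [c] twice each, for a total of [2 n (a + b + c) = 2 n^2]. Other
    triangles contribute nothing. *)
Lemma dot_lap1_flow :
  dot (lap1 T flow) flow = 2 * n%:R ^+ 2 * triangles A B C.
Proof.
have -> : dot (lap1 T flow) flow = dot (lap1 T weight) weight.
  apply: eq_bigr => -[x y] _; rewrite (lap1_restrict ETc) /flow rmorphM /= adj_conj.
  by rewrite -[in RHS](lap1_supp ETc); ring.
rewrite dot_pair.
transitivity (n%:R * (c * (triangles C A B + triangles C B A)
  + a * (triangles A B C + triangles A C B)
  + b * (triangles B C A + triangles B A C))).
  have t3E S S' S'' : triangles S S' S'' =
      \sum_x \sum_y \sum_v tri K T v x y * (ind S v * ind S' x * ind S'' y).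
    rewrite /triangles exchange_big; apply: eq_bigr => x _.
    by rewrite exchange_big.
  rewrite !t3E -!big_split !mulr_sumr -!big_split mulr_sumr; apply: eq_bigr => x _ /=.
  rewrite -!big_split !mulr_sumr -!big_split mulr_sumr; apply: eq_bigr => y _ /=.
  rewrite -!big_split !mulr_sumr -!big_split mulr_sumr /lap1 mulr_suml.
  apply: eq_bigr => v _; rewrite /weight /= natr_parts.
  rewrite !(rmorphM, rmorphD, rmorphB) /= !ind_conj !conjC_nat.
  by case: (partP x) => _; case: (partP y) => _; case: (partP v) => _; ring.
rewrite (trianglesC C A) (trianglesAC A C) (trianglesC C B) (trianglesAC B C).
by rewrite (trianglesC B A) natr_parts; ring.
Qed.

(** * Expander mixing estimates for the flow *)

Variables k0 mu : K.
Hypothesis k0_real : k0 \is Num.real.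
Hypothesis spec0 : nontriv_spec0_in E (fun x => (k0 - mu <= x) && (x <= k0 + mu)).

Local Notation R := (deviation E k0).

Definition nbr (S : {set 'I_n}) x : K := \sum_v w v x * ind S v.

Lemma nbrE S x : nbr S x = (\sum_v w v x) * ind S x - R (ind S) x
  - k0 * (ind S x - #|S|%:R / n%:R).
Proof.
rewrite /deviation /center /mean bd0_ind uplap0E mulr_suml.
have -> : \sum_v w v x * (ind S x - ind S v) =
    \sum_v w v x * ind S x - nbr S x.
  by rewrite -sumrB; apply: eq_bigr => v _; rewrite mulrBr.
by ring.
Qed.

(** Exact form of the expander mixing lemma: adjacency is degree minus Laplacian, and the degree
    term vanishes by disjointness. *)
Lemma edgesE (S S' : {set 'I_n}) : [disjoint S & S'] ->
  edges S S' = k0 * #|S|%:R * #|S'|%:R / n%:R - dot (R (ind S)) (ind S').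
Proof.
move=> dS; have -> : edges S S' = \sum_y nbr S y * ind S' y.
  rewrite /edges exchange_big; apply: eq_bigr => y _; rewrite mulr_suml.
  by apply: eq_bigr => x _; rewrite mulrA.
have -> : k0 * #|S|%:R * #|S'|%:R / n%:R = \sum_y k0 * #|S|%:R / n%:R * ind S' y.
  by rewrite -mulr_sumr -[\sum_y _]/(bd0 (ind S')) bd0_ind; ring.
rewrite -sumrB; apply: eq_bigr => y _; rewrite nbrE ind_conj.
have e : ind S y * ind S' y = 0.
  rewrite /ind; have [yS|_] := boolP (y \in S); last by rewrite mul0r.
  by rewrite (disjointFr dS yS) mulr0.
ring: e.
Qed.

(** At [x] in [A] only neighbours in [B] and [C] count, so no degree appears, and the main terms
    [- c k0 b / n] and [b k0 c / n] cancel; the weights are chosen for this. The other parts are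
    alike. *)
Lemma bd1_flow x : bd1 E (fun x y => flow (x, y)) x =
  c * (R (ind B) x * ind A x - R (ind A) x * ind B x)
  + a * (R (ind C) x * ind B x - R (ind B) x * ind C x)
  + b * (R (ind A) x * ind C x - R (ind C) x * ind A x).
Proof.
transitivity (c * (nbr A x * ind B x - nbr B x * ind A x)
  + a * (nbr B x * ind C x - nbr C x * ind B x)
  + b * (nbr C x * ind A x - nbr A x * ind C x)).
  rewrite bd1E /nbr !mulr_suml -!sumrB !mulr_sumr -!big_split; apply: eq_bigr => v _ /=.
  have e := adj_idem K E v x; rewrite /flow /weight /=; ring: e.
by rewrite !nbrE; case: (partP x) => _; ring.
Qed.

(** Since [A] and [B] are nonempty and disjoint, the centered indicator of [A] is a nonzero function
    of zero sum, so the spectral interval cannot be empty. *)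
Lemma mu_ge0 : mu \is Num.real -> 0 <= mu.
Proof.
move=> mu_real; pose z := center (ind A).
have z0 : bd0 z = 0 by apply: bd0_center.
have := le_trans (uplap0_ge n_gt0 spec0 z0) (uplap0_le n_gt0 spec0 z0).
rewrite -subr_ge0 -mulrBl => h.
have zz : 0 < dot z z.
  rewrite lt_neqAle dot_ge0 andbT eq_sym; apply/eqP => /dot_eq0 z_eq0.
  case: ABC => [[/set0Pn[x xA] /set0Pn[y yB] _] [/setP/(_ y) AB _ _ _]].
  have : z x - z y = 0 by rewrite !z_eq0 subrr.
  rewrite /z /center /ind xA; move: AB; rewrite !inE yB andbT => ->.
  by move/eqP; rewrite mulr1n mulr0n (_ : _ - _ = 1) ?oner_eq0 //; ring.
move: h; rewrite pmulr_lge0 // (_ : _ - _ = mu *+ 2); last by ring.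
by rewrite pmulrn_lge0.
Qed.

Hypothesis mu0 : 0 <= mu.

(** The error is bounded through [polarization_le], with an arithmetic mean of [|S|] and [|S'|] in
    place of the usual geometric one, which keeps everything polynomial. *)
Lemma edges_ge (S S' : {set 'I_n}) : [disjoint S & S'] ->
  2 * k0 * #|S|%:R * #|S'|%:R / n%:R - mu * (#|S|%:R + #|S'|%:R)
    <= edges S S' + edges S' S.
Proof.
move=> dS; have := polarization_le (deviation_selfadjoint E k0_real)
  (fun u => deviation_bound n_gt0 spec0 u mu0) (ind S) (ind S').
rewrite !dot_ind edgesE // edgesE 1?disjoint_sym // => h.
rewrite -subr_ge0; move: h; rewrite -subr_ge0; congr (0 <= _); ring.
Qed.

Lemma dot_flow_ge : 2 * k0 * (a * b * c)
  - mu * (c ^+ 2 * (a + b) + a ^+ 2 * (b + c) + b ^+ 2 * (c + a)) <= dot flow flow.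
Proof.
case: ABC => _ [AB BC AC _].
have dis (S S' : {set 'I_n}) : S :&: S' = set0 -> [disjoint S & S'] by rewrite -setI_eq0 => ->.
have sq (x : nat) : 0 <= x%:R ^+ 2 :> K by rewrite exprn_ge0 ?ler0n.
have hAB := ler_wpM2l (sq #|C|) (edges_ge (dis _ _ AB)).
have hBC := ler_wpM2l (sq #|A|) (edges_ge (dis _ _ BC)).
have hCA := ler_wpM2l (sq #|B|) (edges_ge (dis C A (etrans (setIC _ _) AC))).
rewrite dot_flow; apply: le_trans (lerD (lerD hAB hBC) hCA).
rewrite le_eqVlt; apply/orP; left; apply/eqP.
(* The main terms add up to [2 k0 a b c (a + b + c) / n], where [n = a + b + c]. *)
have := n_neq0; rewrite natr_parts => ?; by field.
Qed.

(** Pointwise, two of the three deviations occur, with coefficients at most [n]; the bound is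
    enlarged to all three, and summing [|R (ind S)|^2 <= mu^2 |S|] over the parts supplies the third
    factor [n]. *)
Lemma dot_bd1_flow_le :
  dot (bd1 E (fun x y => flow (x, y))) (bd1 E (fun x y => flow (x, y)))
    <= 2 * n%:R ^+ 3 * mu ^+ 2.
Proof.
have Rle S := dot_deviation_le n_gt0 spec0 (ind S) k0_real mu0.
have le_n (S : {set 'I_n}) : 0 <= (#|S|%:R : K) <= n%:R.
  by rewrite ler0n ler_nat -[leqRHS]card_ord max_card.
pose rr S := dot (R (ind S)) (R (ind S)).
apply: (@le_trans _ _ (2 * n%:R ^+ 2 * (rr A + rr B + rr C))); last first.
  have -> : 2 * n%:R ^+ 3 * mu ^+ 2 = 2 * n%:R ^+ 2 *
      (mu ^+ 2 * a + mu ^+ 2 * b + mu ^+ 2 * c).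
    by rewrite natr_parts; ring.
  apply: ler_wpM2l; first by rewrite mulr_ge0 ?exprn_ge0 ?ler0n.
  by rewrite /rr -!dot_ind !lerD.
rewrite /rr /dot -!big_split mulr_sumr; apply: ler_sum => x _ /=; rewrite bd1_flow.
set rA := R (ind A) x; set rB := R (ind B) x; set rC := R (ind C) x.
have N0 : 0 <= 2 * n%:R ^+ 2 :> K by rewrite mulr_ge0 ?exprn_ge0 ?ler0n.
case: (partP x) => _.
- have -> : c * (rB * 1 - rA * 0) + a * (rC * 0 - rB * 0) + b * (rA * 0 - rC * 1)
    = c * rB - b * rC by ring.
  apply: le_trans (dist_norm_sqr_le _ _ (le_n C) (le_n B)) _.
  by rewrite ler_wpM2l // -addrA lerDr mul_conjC_ge0.
- have -> : c * (rB * 0 - rA * 1) + a * (rC * 1 - rB * 0) + b * (rA * 0 - rC * 0)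
    = a * rC - c * rA by ring.
  apply: le_trans (dist_norm_sqr_le _ _ (le_n A) (le_n C)) _.
  by rewrite ler_wpM2l // [leLHS]addrC lerD2r lerDl mul_conjC_ge0.
- have -> : c * (rB * 0 - rA * 0) + a * (rC * 0 - rB * 1) + b * (rA * 1 - rC * 0)
    = b * rA - a * rB by ring.
  apply: le_trans (dist_norm_sqr_le _ _ (le_n B) (le_n A)) _.
  by rewrite ler_wpM2l // lerDl mul_conjC_ge0.
Qed.

End TransversalFlow.

Theorem theorem1p2 (K : numClosedFieldType) (n : nat)
  (E T : {set {set 'I_n}}) (k0 mu0 lam1 : K) :
  is_triangle_complex E T ->
  k0 \is Num.real -> mu0 \is Num.real -> 0 <= lam1 ->
  nontriv_spec0_in E (fun x => (k0 - mu0 <= x) && (x <= k0 + mu0)) ->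
  nontriv_spec1_in E T (fun x => lam1 <= x) ->
  forall A B C : {set 'I_n}, is_partition3 A B C ->
    (#|triABC T A B C|%:R * n%:R ^+ 2) / (#|A| * #|B| * #|C|)%:R >=
    lam1 * (k0 - mu0 * (1 + (10 * n%:R ^+ 3) / (9 * (#|A| * #|B| * #|C|)%:R))).
Proof.
move=> ETc k0r mu0r lam0 spec0 spec1 A B C ABC.
have mu_ge0 := mu_ge0 ABC spec0 mu0r.
have [[A0 B0 C0] _] := ABC.
have n_gt0 : (0 < n)%N by case/set0Pn: A0 => x _; apply: leq_ltn_trans (ltn_ord x).
have nE := natr_parts K ABC.
rewrite !natrM.
have a_gt0 : 0 < #|A|%:R :> K by rewrite ltr0n card_gt0.
have b_gt0 : 0 < #|B|%:R :> K by rewrite ltr0n card_gt0.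
have c_gt0 : 0 < #|C|%:R :> K by rewrite ltr0n card_gt0.
have N_real : n%:R \is @Num.real K by apply: realn.
have FF := dot_flow_ge ABC k0r spec0 mu_ge0.
have BF := dot_bd1_flow_le ABC k0r spec0 mu_ge0.
have LF := dot_lap1_flow K ABC ETc.
have tri_le := triangles_le K T ABC.
move: FF BF LF tri_le nE a_gt0 b_gt0 c_gt0 N_real.
set a := #|A|%:R; set b := #|B|%:R; set c := #|C|%:R; set N := n%:R.
set X := #|_|%:R; move=> FF BF LF tri_le nE a_gt0 b_gt0 c_gt0 N_real.
have X_ge0 : 0 <= X by apply: ler0n.
have D_gt0 : 0 < a * b * c by rewrite !mulr_gt0.
have N_ge0 : 0 <= N by apply: ler0n.
have N2_ge0 : 0 <= N ^+ 2 by apply: exprn_ge0.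
rewrite ler_pdivlMr //.
pose G := k0 * (a * b * c) - mu0 * (a * b * c + 10 / 9 * N ^+ 3).
have -> : lam1 * (k0 - mu0 * (1 + 10 * N ^+ 3 / (9 * (a * b * c)))) * (a * b * c)
          = lam1 * G.
  have an0 := lt0r_neq0 a_gt0; have bn0 := lt0r_neq0 b_gt0.
  have cn0 := lt0r_neq0 c_gt0; rewrite /G; field.
  by rewrite an0 bn0 cn0.
have D_real : a * b * c \is Num.real by apply: gtr0_real.
(* The order on [K] is partial, so splitting on the sign of [G] requires that it be real. For
   [G <= 0] the claim is trivial. *)
have G_real : G \is Num.real.
  apply: realB; first exact: realM.
  apply: realM => //; apply: realD => //; apply: realM; last exact: rpredX.
  by apply: ger0_real; rewrite divr_ge0 ?ler0n.
have [G_le0|G_gt0] := real_leP G_real (real0 K).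
  by apply: le_trans (mulr_ge0_le0 lam0 G_le0) _; rewrite mulr_ge0.
have kap_D : 10 / 9 * (mu0 * N ^+ 3) <= (k0 - mu0) * (a * b * c).
  by rewrite -subr_ge0; move: (ltW G_gt0); congr (0 <= _); rewrite /G; field.
have muN_ge0 : 0 <= mu0 * N ^+ 3 by rewrite mulr_ge0 ?exprn_ge0.
have kap_gt0 : 0 < k0 - mu0.
  rewrite -(pmulr_lgt0 _ D_gt0).
  have -> : (k0 - mu0) * (a * b * c) = G + 10 / 9 * (mu0 * N ^+ 3).
    by rewrite /G; field.
  by rewrite ltr_wpDr // mulr_ge0 // divr_ge0 ?ler0n.
have [q [kq Lq]] := lap1_isoperimetric ETc n_gt0 spec0 kap_gt0 spec1
                      (Omega1_flow K E A B C).
(* In [(k0 - mu0) q <= 2 N^3 mu0^2], [kap_D] replaces one factor [mu0 N^3] by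
   [9/10 (k0 - mu0) a b c]; hence [9/5]. *)
have q_le : q <= 9 / 5 * (mu0 * (a * b * c)).
  rewrite -(ler_pM2l kap_gt0); apply: le_trans kq _; apply: le_trans BF _.
  have -> : 2 * N ^+ 3 * mu0 ^+ 2 = 9 / 5 * mu0 * (10 / 9 * (mu0 * N ^+ 3)) by field.
  have -> : (k0 - mu0) * (9 / 5 * (mu0 * (a * b * c))) =
    9 / 5 * mu0 * ((k0 - mu0) * (a * b * c)) by ring.
  by rewrite ler_wpM2l // mulr_ge0 // divr_ge0 ?ler0n.
have G_le : 2 * G <= dot (flow K E A B C) (flow K E A B C) - 2 * q.
  have h := lerB FF (ler_wpM2l (ler0n K 2) q_le); apply: le_trans h.
  rewrite -subr_ge0.
  set S := c ^+ 2 * (a + b) + a ^+ 2 * (b + c) + b ^+ 2 * (c + a).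
  (* Since [N^3 = a^3 + b^3 + c^3 + 3 S + 6 a b c], the term [20/9 N^3] absorbs both errors: the
     coefficients left are [20/9], [17/3 = 20/3 - 1] and [176/15 = 40/3 + 2 - 18/5], all
     positive. *)
  have -> : 2 * k0 * (a * b * c) - mu0 * S - 2 * (9 / 5 * (mu0 * (a * b * c))) - 2 * G
    = mu0 * (20 / 9 * (a ^+ 3 + b ^+ 3 + c ^+ 3) + 17 / 3 * S + 176 / 15 * (a * b * c)).
    by rewrite /G /S nE; field.
  have [a0 b0 c0] : [/\ 0 <= a, 0 <= b & 0 <= c] by split; apply: ltW.
  have q0 (i j : nat) : 0 <= i%:R / j%:R :> K by rewrite divr_ge0 ?ler0n.
  have S0 : 0 <= S by rewrite /S !addr_ge0 // mulr_ge0 ?addr_ge0 ?exprn_ge0.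
  have cubes0 : 0 <= a ^+ 3 + b ^+ 3 + c ^+ 3 by rewrite !addr_ge0 ?exprn_ge0.
  apply: mulr_ge0 => //; apply: addr_ge0; last by rewrite mulr_ge0 // ltW.
  by apply: addr_ge0; rewrite mulr_ge0.
(* Both sides are doubled to match [dot], which counts each edge in both orientations. *)
rewrite -(ler_pM2l (ltr0Sn K 1)).
have -> : 2 * (lam1 * G) = lam1 * (2 * G) by ring.
apply: le_trans (ler_wpM2l lam0 G_le) _; apply: le_trans Lq _.
by rewrite LF -mulrA ler_wpM2l ?ler0n // mulrC ler_wpM2r.
Qed.
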